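(* There is an absolute constant $C$ such that the following holds. Let $P$ be a poset of height $h$ with $|P|\ge 2$, and let $k\ge 2$ and $n$ be positive integers with $n\ge 2\log_2|P|$. Let $w$ be the width of $[k]^n$. If $\mathcal{F}\subset[k]^n$ does not contain a weak copy of $P$, then $|\mathcal{F}|\le C\, w\, h\,(\log_2|P|)^{3/2}$. In particular, $\mathrm{La}(n,P)\le C\binom{n}{\lfloor n/2\rfloor}h(\log_2|P|)^{3/2}$.
   Context: $[k]^n$ denotes the grid $\{1,\dots,k\}^n$ with the coordinatewise partial order. The width of a poset is the size of its largest antichain; the height is the size of its largest chain. A subset $P'\subset Q$ is a weak copy of $P$ if there is a bijection $\pi:P\to P'$ such that $x\le_P y$ implies $\pi(x)\le_Q\pi(y)$. $\mathrm{La}(n,P)$ is the maximum size of a family in the Boolean lattice $2^{[n]}\cong[2]^n$ containing no weak copy of $P$. *)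

(* Defs.v *)
From HB Require Import structures.
From mathcomp Require Import all_boot all_order.
From Stdlib Require Import Reals.

Set Implicit Arguments.
Unset Strict Implicit.
Unset Printing Implicit Defensive.

Definition is_chain (T : finType) (r : rel T) (A : {set T}) : bool :=
  [forall x in A, forall y in A, r x y || r y x].

Definition is_antichain (T : finType) (r : rel T) (A : {set T}) : bool :=
  [forall x in A, forall y in A, r x y ==> (x == y)].

Definition height_of (T : finType) (r : rel T) : nat :=
  \max_(A : {set T} | is_chain r A) #|A|.

Definition width_of (T : finType) (r : rel T) : nat :=
  \max_(A : {set T} | is_antichain r A) #|A|.

(* The grid [k]^n : functions {0..n-1} -> {0..k-1} (values shifted by one
   from {1..k}, which does not affect the order), coordinatewise order. *)
Definition grid (n k : nat) : finType := {ffun 'I_n -> 'I_k}.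

Definition grid_le (n k : nat) : rel (grid n k) :=
  fun f g => [forall i, (f i <= g i)%N].

Definition subset_le (n : nat) : rel {set 'I_n} := fun A B => A \subset B.

Definition contains_weak_copy (T Q : finType) (rP : rel T) (rQ : rel Q)
    (F : {set Q}) : Prop :=
  exists pi : T -> Q,
    [/\ injective pi, (forall x, pi x \in F) &
        (forall x y, rP x y -> rQ (pi x) (pi y))].

Definition log2 (x : R) : R := (ln x / ln 2)%R.

(* Main.v *)
Require Import Defs.
From HB Require Import structures.
From mathcomp Require Import all_boot all_order.
From Stdlib Require Import Reals Lra.
From mathcomp Require Import ssrnat zify.

(* Let 2^d >= |P|, with d of order log |P|, and split the n coordinates into d
   classes of about n/d coordinates. Each factor [k]^(n/d) is partitioned into
   symmetric chains, which partitions [k]^n into d-dimensional grids. Cut every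
   chain into pairs of consecutive points, and every grid accordingly into
   blocks of 2^d points; the blocks on a diagonal of the grid of blocks are
   totally ordered, all points of one lying below all points of the next. If a
   diagonal contains h (|P| + 2^d) points of F, then listing them by block and
   spacing the h ranks of P by |P| + 2^d gives a weak copy of P. Every diagonal
   starts with a block of 2^d points, all at the bottom of a chain in some
   class, so |F| is at most of order h times the sum over the classes of the
   number of points of [k]^n whose projection to the class lies on a given
   level of a chain; every chain meets the middle level, so this is bounded by
   the number of points whose projection is in the middle level. That is
   O(k^(n-1) / sqrt (n/d)), while the width of [k]^n is at least of order
   k^(n-1) / sqrt n by Chebyshev's inequality. Altogether |F| = O(w h d^(3/2)). *)

Set Implicit Arguments.
Unset Strict Implicit.
Unset Printing Implicit Defensive.

(** * Symmetric chains *)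

(* The symmetric chain decomposition of [k]^s: (chain, position in it, length).
   For a chain of length l in the last s - 1 coordinates, the rectangle
   [l] x [k] splits into hooks; hook j runs along row r = j up to column
   p = l - 1 - j and then up that column. *)
Fixpoint scd (k : nat) (s : seq nat) : seq nat * nat * nat :=
  if s is r :: s' then
    let: (c, p, l) := scd k s' in
    let j := minn r (l.-1 - p) in (j :: c, p + r - j, l + k.-1 - j.*2)
  else ([::], 0, 1).

Definition chain_id k s := (scd k s).1.1.
Definition chain_pos k s := (scd k s).1.2.
Definition chain_len k s := (scd k s).2.

Lemma chain_id_cons k r s : chain_id k (r :: s) =
  minn r ((chain_len k s).-1 - chain_pos k s) :: chain_id k s.
Proof. by rewrite /chain_id /chain_len /chain_pos /=; case: scd => [[c p] l]. Qed.

Lemma chain_pos_cons k r s : chain_pos k (r :: s) =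
  chain_pos k s + r - minn r ((chain_len k s).-1 - chain_pos k s).
Proof. by rewrite /chain_id /chain_len /chain_pos /=; case: scd => [[c p] l]. Qed.

Lemma chain_len_cons k r s : chain_len k (r :: s) =
  chain_len k s + k.-1 - (minn r ((chain_len k s).-1 - chain_pos k s)).*2.
Proof. by rewrite /chain_id /chain_len /chain_pos /=; case: scd => [[c p] l]. Qed.

Lemma chain_pos_lt k s : all (ltn^~ k) s -> chain_pos k s < chain_len k s.
Proof.
elim: s => [//|r s IH] /= /andP[rk /IH].
rewrite chain_pos_cons chain_len_cons; lia.
Qed.

Lemma chain_id_len k s t : chain_id k s = chain_id k t -> chain_len k s = chain_len k t.
Proof.
elim: s t => [|r s IH] [|r' t]; rewrite ?chain_id_cons // => -[j /IH l].
by rewrite !chain_len_cons -j l.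
Qed.

(** On hook j the point at position q has column p = min(q, l - 1 - j) and row j + q - p, both
    nondecreasing in q. *)
Lemma chain_pos_mono k s t : all (ltn^~ k) s -> all (ltn^~ k) t ->
  chain_id k s = chain_id k t -> chain_pos k s <= chain_pos k t -> all2 leq s t.
Proof.
elim: s t => [|r s IH] [|r' t]; rewrite ?chain_id_cons //= => /andP[rk vs] /andP[rk' vt].
move=> [j e]; have l := chain_id_len e.
have ps := chain_pos_lt vs; have pt := chain_pos_lt vt.
rewrite !chain_pos_cons => le; apply/andP; split; first by lia.
by apply: IH => //; lia.
Qed.

(** This is the symmetry of the chains: the sums at the two ends of a chain add up to
    [size s * k.-1]. *)
Lemma chain_pos_sum k s : all (ltn^~ k) s ->
  (sumn s).*2 + chain_len k s = size s * k.-1 + (chain_pos k s).*2 + 1.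
Proof.
elim: s => [//|r s IH] /= /andP[rk vs].
have ps := chain_pos_lt vs; have := IH vs.
rewrite chain_pos_cons chain_len_cons; lia.
Qed.

Lemma chain_pos_surj k s q : all (ltn^~ k) s -> q < chain_len k s ->
  exists t, [/\ all (ltn^~ k) t, size t = size s, chain_id k t = chain_id k s
    & chain_pos k t = q].
Proof.
elim: s q => [|r s IH] q /=; first by move=> _; case: q => // _; exists [::].
move=> /andP[rk vs]; rewrite chain_len_cons.
have ps := chain_pos_lt vs.
set j := minn _ _ => qj.
have jl : j < chain_len k s by lia.
have [t [vt st et pt]] := IH (minn q ((chain_len k s).-1 - j)) vs ltac:(lia).
have lt := chain_id_len et.
exists (j + q - minn q ((chain_len k s).-1 - j) :: t).
rewrite chain_id_cons chain_pos_cons pt lt et /= vt st; split=> //; try lia.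
by rewrite chain_id_cons; congr cons; lia.
Qed.

Lemma all2_leq_anti s t : all2 leq s t -> all2 leq t s -> s = t.
Proof.
elim: s t => [|r s IH] [|r' t] //= /andP[a b] /andP[c e].
by rewrite (IH _ b e); congr cons; lia.
Qed.

Lemma chain_pos_inj k s t : all (ltn^~ k) s -> all (ltn^~ k) t ->
  chain_id k s = chain_id k t -> chain_pos k s = chain_pos k t -> s = t.
Proof.
move=> vs vt e p; apply: all2_leq_anti; apply: (@chain_pos_mono k) => //; lia.
Qed.

(** Count from both sides the pairs of a point of [F] and a point of [A] with equal [D]. *)
Lemma fibre_double_count (T : finType) (K : eqType) (D : T -> K) (F A : {set T}) a b :
  (forall x, x \in F -> #|[set y in F | D y == D x]| <= a) ->
  (forall x, x \in F -> b <= #|[set y in A | D y == D x]|) ->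
  #|F| * b <= #|A| * a.
Proof.
move=> Fa Ab.
have e (X Y : {set T}) : \sum_(x in X) \sum_(y in Y) (D y == D x) =
    \sum_(x in X) #|[set y in Y | D y == D x]|.
  apply: eq_bigr => x _; rewrite -sum1_card -big_mkcondr.
  by apply: eq_bigl => y; rewrite inE.
rewrite -!sum_nat_const; apply: (leq_trans (leq_sum _ Ab)); rewrite -e exchange_big /=.
under eq_bigr do under eq_bigr do rewrite eq_sym.
rewrite e; apply: leq_sum => y _.
have [->|[x]] := set_0Vmem [set x in F | D x == D y]; first by rewrite cards0.
by rewrite inE => /andP[xF /eqP <-]; apply: Fa.
Qed.

(** * Weak copies from ordered levels *)

Lemma is_chainP (T : finType) (r : rel T) (A : {set T}) :
  reflect {in A &, forall x y, r x y || r y x} (is_chain r A).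
Proof.
apply: (iffP forallP) => [c x y xA yA|c x].
  by have /implyP/(_ xA)/forallP/(_ y)/implyP := c x; apply.
by apply/implyP => xA; apply/forallP => y; apply/implyP; apply: c.
Qed.

Section PosetRank.
Import Order.TTheory.
Context {d : Order.disp_t} {P : finPOrderType d}.
Implicit Types (x y : P) (A : {set P}).
Let leP := fun x y : P => (x <= y)%O.

Definition chain_below x A := is_chain leP A && [forall y in A, (y < x)%O].

Definition poset_rank x := \max_(A : {set P} | chain_below x A) #|A|.

Lemma chain_belowU1 x A : chain_below x A ->
  is_chain leP (x |: A) /\ #|x |: A| = #|A|.+1.
Proof.
case/andP=> /is_chainP cA /forallP Ax'.
have Ax y : y \in A -> (y < x)%O by have /implyP := Ax' y.
split; last by rewrite cardsU1; case: (boolP (x \in A)) => // /Ax; rewrite ltxx.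
apply/is_chainP => y z; rewrite !inE /leP.
case/orP=> [/eqP ->|yA]; case/orP=> [/eqP ->|zA]; rewrite ?lexx //.
- by rewrite (ltW (Ax _ zA)) orbT.
- by rewrite (ltW (Ax _ yA)).
- exact: cA.
Qed.

Lemma poset_rank_witness x : exists2 A, chain_below x A & #|A| = poset_rank x.
Proof.
have b0 : chain_below x set0.
  apply/andP; split; first by apply/is_chainP => y z; rewrite inE.
  by apply/forallP => y; rewrite inE.
have c0 : 0 < #|chain_below x| by apply/card_gt0P; exists set0.
by have [A bA e] := eq_bigmax_cond (fun A : {set P} => #|A|) c0; exists A.
Qed.

Lemma poset_rank_lt_height x : poset_rank x < height_of leP.
Proof.
have [A bA <-] := poset_rank_witness x.
have [cU <-] := chain_belowU1 bA.
exact: (@leq_bigmax_cond _ _ (fun A : {set P} => #|A|)).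
Qed.

Lemma poset_rank_mono x y : (x < y)%O -> poset_rank x < poset_rank y.
Proof.
move=> xy; have [A bA <-] := poset_rank_witness x.
have [cU <-] := chain_belowU1 bA.
apply: (@leq_bigmax_cond _ _ (fun A : {set P} => #|A|)).
rewrite /chain_below cU; apply/forallP => z; apply/implyP; rewrite !inE.
case/orP=> [/eqP -> //|zA]; apply: lt_trans xy.
by case/andP: bA => _ /forallP/(_ z)/implyP; apply.
Qed.

(* List [G] by increasing level and send the i-th element of rank a to
   position a (|P| + c) + i: positions more than [c] apart have different
   levels, since a level has at most [c] elements. *)
Lemma weak_copy_of_levels (Q : finType) (rQ : rel Q) (G : {set Q}) (m : Q -> nat) c :
  reflexive rQ -> {in G &, forall u v, m u < m v -> rQ u v} ->
  (forall a, #|[set u in G | m u == a]| <= c) ->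
  height_of leP * (#|P| + c) <= #|G| ->
  contains_weak_copy leP rQ G.
Proof.
move=> rr mG mc hG.
pose r := relpre m leq; pose s := sort r (enum G).
have ps : perm_eq s (enum G) by rewrite perm_sort.
have us : uniq s by rewrite (perm_uniq ps) enum_uniq.
have ss : size s = #|G| by rewrite (perm_size ps) cardE.
have sG u : u \in s = (u \in G) by rewrite (perm_mem ps) mem_enum.
have os : sorted r s by apply: sort_sorted => u v; apply: leq_total.
have [P0|[x0 _]] := set_0Vmem [set: P].
  have em (x : P) : False by have := in_setT x; rewrite P0 inE.
  by exists (fun x => False_rect _ (em x)); split=> x; case: (em x).
have er x : enum_rank x < #|P| by exact: ltn_ord.
pose pos (x : P) := poset_rank x * (#|P| + c) + enum_rank x.
have posL x : pos x < #|G|.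
  apply: leq_trans hG; apply: (@leq_trans ((poset_rank x).+1 * (#|P| + c))).
    by rewrite /pos mulSn; have := er x; lia.
  by rewrite leq_mul2r poset_rank_lt_height orbT.
have [q0 _] : exists q, q \in G by apply/card_gt0P; apply: leq_trans (posL x0).
have far i j : i + c < j -> j < #|G| -> m (nth q0 s i) < m (nth q0 s j).
  move=> ij jG; rewrite ltnNge; apply/negP => mji.
  have mono u v : u <= v -> v < #|G| -> m (nth q0 s u) <= m (nth q0 s v).
    move=> uv vG; apply: (sorted_leq_nth _ _ _ os) => //.
    - by move=> a b e; apply: leq_trans.
    - by move=> a; apply: leqnn.
    - by rewrite inE ss; lia.
    - by rewrite inE ss.
  (* Otherwise the c + 1 entries from position i on would all lie on a single level. *)
  pose t := [seq nth q0 s (i + u) | u <- iota 0 c.+1].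
  have ut : uniq t.
    rewrite map_inj_in_uniq ?iota_uniq // => u v; rewrite !mem_iota => hu hv /eqP.
    by rewrite nth_uniq ?ss //; lia.
  suff : c < c by rewrite ltnn.
  apply: leq_trans (mc (m (nth q0 s i))).
  rewrite -[c.+1](size_iota 0) -(size_map (fun u => nth q0 s (i + u))) -(card_uniqP ut).
  apply: subset_leq_card; apply/subsetP => y /mapP[u]; rewrite mem_iota => hu ->.
  rewrite inE -sG mem_nth ?ss ?eqn_leq; last by lia.
  rewrite (mono i (i + u)); [|lia..]; rewrite andbT.
  by apply: leq_trans mji; apply: mono; lia.
have pos_far x y : (x < y)%O -> pos x + c < pos y.
  move=> /poset_rank_mono xy; rewrite /pos.
  have : (poset_rank x).+1 * (#|P| + c) <= poset_rank y * (#|P| + c) by rewrite leq_mul2r xy orbT.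
  by rewrite mulSn; have := er x; lia.
have inG x : nth q0 s (pos x) \in G by rewrite -sG mem_nth ?ss.
exists (fun x => nth q0 s (pos x)); split=> // [x y /eqP|x y].
  rewrite nth_uniq ?ss // => /eqP e; apply: enum_rank_inj; apply: val_inj => /=.
  (* Modulo [#|P| + c] only [enum_rank] remains, which separates the points. *)
  have := congr1 (modn^~ (#|P| + c)) e.
  rewrite /pos !modnMDl !modn_small //; apply: ltn_addr; exact: er.
rewrite /leP le_eqVlt => /predU1P[-> //|xy]; apply: mG => //.
exact: far (pos_far _ _ xy) (posL y).
Qed.

End PosetRank.

(** * Anti-concentration of coordinate sums *)

Lemma bin_le_center n j : 'C(n, j) <= 'C(n, n./2).
Proof.
have up i : i < n./2 -> 'C(n, i) <= 'C(n, i.+1).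
  by move=> hi; have := mul_bin_left n i; nia.
have low i : i <= n./2 -> 'C(n, i) <= 'C(n, n./2).
  elim: {i}(n./2 - i) {-2}i (erefl (n./2 - i)) => [|e IH] i he hi.
    by rewrite (_ : i = n./2) //; lia.
  by apply: leq_trans (up i _) (IH _ _ _); lia.
have [jn|nj] := leqP j n; last by rewrite bin_small.
have [/low //|hj] := leqP j n./2.
by rewrite -bin_sub //; apply: low; lia.
Qed.

Lemma central_bin_double m : 'C(m.*2.+2, m.+1) = 2 * 'C(m.*2.+1, m).
Proof.
have hm : m <= m.*2.+1 by lia.
by rewrite binS -(bin_sub hm) (_ : m.*2.+1 - m = m.+1); lia.
Qed.

(** From m to m + 1 the left side grows by the factor 4 (2m + 1) (2m + 3) / (m + 1)^2, which is
    below 16. *)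
Lemma central_bin_even m : m.*2.+1 * 'C(m.*2, m) ^ 2 <= 16 ^ m.
Proof.
elim: m => [//|m IH].
have e : m.+1 * 'C(m.+1.*2, m.+1) = 2 * m.*2.+1 * 'C(m.*2, m).
  by have := mul_bin_down m.*2.+1 m; rewrite /= doubleS central_bin_double; nia.
rewrite -(@leq_pmul2l (m.+1 ^ 2)) ?expn_gt0 //.
have -> : m.+1 ^ 2 * (m.+1.*2.+1 * 'C(m.+1.*2, m.+1) ^ 2) =
    m.+1.*2.+1 * (2 * m.*2.+1 * 'C(m.*2, m)) ^ 2 by rewrite -e expnMn; lia.
rewrite !expnMn (expnS 16).
have h : 4 * (m.+1.*2.+1 * m.*2.+1) <= 16 * m.+1 ^ 2 by rewrite expnS expn1; nia.
have -> : m.+1.*2.+1 * (2 ^ 2 * m.*2.+1 ^ 2 * 'C(m.*2, m) ^ 2) =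
  4 * (m.+1.*2.+1 * m.*2.+1) * (m.*2.+1 * 'C(m.*2, m) ^ 2) by lia.
by rewrite [leqRHS]mulnCA [leqRHS]mulnA; apply: leq_mul.
Qed.

Lemma central_bin_sq n : n.+1 * 'C(n, n./2) ^ 2 <= 4 ^ n.
Proof.
have e16 m : 16 ^ m = 4 ^ m.*2 by rewrite -mul2n expnM.
rewrite -(odd_double_half n); move: (n./2) => m; case: (odd n) => /=.
  (* The odd case comes from the next even one, whose central coefficient is twice as large. *)
  rewrite add1n /= uphalf_double.
  have := central_bin_even m.+1; rewrite e16 doubleS central_bin_double expnMn (expnS 4).
  set c := 'C(_, _) ^ 2; set t := 4 ^ _; lia.
by rewrite add0n doubleK -e16 central_bin_even.
Qed.

(* AM-GM for the factors a / sqrt (n + 1) and its inverse, kept in nat. *)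
Lemma central_bin_amgm a n :
  2 * a * ('C(n, n./2) * n.+1) <= 2 ^ n * (a ^ 2 + n.+1).
Proof.
rewrite -leq_sqr; have := central_bin_sq n.
have -> : 4 ^ n = (2 ^ n) ^ 2 by rewrite -expnM mulnC expnM.
rewrite !expnMn; move: ('C(_, _) ^ 2) ((2 ^ n) ^ 2) => c t ct.
apply: (@leq_trans (4 * a ^ 2 * n.+1 * t)); first last.
  by rewrite mulnC leq_mul2l -mulnA nat_AGM2 orbT.
have -> : 2 ^ 2 * a ^ 2 * (c * n.+1 ^ 2) = 4 * a ^ 2 * n.+1 * (n.+1 * c) by lia.
by rewrite leq_mul2l ct orbT.
Qed.

Lemma sum_binS n (f : nat -> nat) :
  \sum_(j < n.+2) 'C(n.+1, j) * f j = \sum_(j < n.+1) 'C(n, j) * (f j + f j.+1).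
Proof.
rewrite big_ord_recl /= bin0 mul1n.
under eq_bigr do rewrite /bump /= add1n binS mulnDl.
under [in RHS]eq_bigr do rewrite mulnDr.
rewrite !big_split /= addnA; congr addn.
by rewrite big_ord_recr [in RHS]big_ord_recl /= bin_small // mul0n addn0 bin0 mul1n.
Qed.

(** The sum of phi(v_1 + ... + v_s) over all v in {0, ..., k - 1}^s. *)
Fixpoint grid_sum k s (phi : nat -> nat) :=
  if s is s'.+1 then grid_sum k s' (fun y => \sum_(v < k) phi (v + y)) else phi 0.

(* Split {0..k-1} into q pairs {u, u + q} and r further elements: summing
   phi over g coordinates that run through pairs gives binomial sums along
   an arithmetic progression of difference q. *)
Lemma grid_sum_le q r s phi (Phi : nat -> nat) :
  (forall g c, \sum_(j < g.+1) 'C(g, j) * phi (c + q * j) <= Phi g) ->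
  grid_sum (q + q + r) s phi <= \sum_(g < s.+1) 'C(s, g) * (r ^ (s - g) * q ^ g * Phi g).
Proof.
elim: s phi Phi => [|s IH] phi Phi H /=.
  by rewrite big_ord1 bin0 !mul1n; have := H 0 0; rewrite big_ord1 mul1n muln0.
apply: leq_trans (IH _ (fun g => r * Phi g + q * Phi g.+1) _) _ => [g c|].
  under eq_bigr do rewrite big_distrr.
  rewrite exchange_big !big_split_ord /= addnC; apply: leq_add.
    rewrite -[r in X in _ <= X]card_ord -sum_nat_const; apply: leq_sum => u _.
    by under eq_bigr do rewrite addnA; apply: H.
  rewrite -big_split -[q in X in _ <= X]card_ord -sum_nat_const; apply: leq_sum => u _ /=.
  rewrite -big_split; apply: leq_trans (H g.+1 (u + c)).
  rewrite (sum_binS g (fun j => phi (u + c + q * j))) eq_leq //; apply: eq_bigr => j _.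
  by rewrite mulnDr; congr (_ * phi _ + _ * phi _); lia.
rewrite (sum_binS s (fun g => r ^ (s.+1 - g) * q ^ g * Phi g)) leq_sum // => g _.
by rewrite subSn -1?ltnS // subSS !expnS; apply: eq_leq; lia.
Qed.

(** A window of length at most 3q holds at most three terms of a progression of difference q:
    indices congruent mod 3 are at least 3q apart. *)
Lemma window_bin_le q k t g c : 0 < q -> k <= 3 * q ->
  \sum_(j < g.+1) 'C(g, j) * (c + q * j <= t < c + q * j + k) <= 3 * 'C(g, g./2).
Proof.
move=> q0 kq.
apply: (@leq_trans (\sum_(j < g.+1 | c + q * j <= t < c + q * j + k) 'C(g, g./2))).
  rewrite [leqRHS]big_mkcond; apply: leq_sum => j _.
  by case: ifP; rewrite ?muln0 // muln1 bin_le_center.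
rewrite sum_nat_const leq_mul2r; apply/orP; right.
rewrite -[3]card_ord; pose f (j : 'I_g.+1) : 'I_3 := inord (j %% 3).
apply: (@leq_card_in _ _ f) => i j.
rewrite !unfold_in => /andP[i1 i2] /andP[j1 j2] /(congr1 val).
rewrite /= !inordK ?ltn_mod // => e; apply: val_inj => /=.
have far u v : u < v -> u %% 3 = v %% 3 -> q * u + 3 * q <= q * v.
  by move=> uv m3; rewrite (mulnC 3) -mulnDr leq_mul2l; lia.
case: (ltngtP i j) => // h; first by have := far _ _ h e; lia.
by have := far _ _ h (esym e); lia.
Qed.

(* With s + 1 coordinates: summing over one of them turns the condition
   "sum = t" into a window of length k for the other s. *)
Lemma grid_sum_window_le k s t a : 2 <= k -> a ^ 2 <= s.+1 ->
  2 * a * k * grid_sum k s (fun y => y <= t < y + k) <= 9 * k ^ s.+1.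
Proof.
move=> k2 ha; pose q := k./2; pose r := (odd k : nat).
have kE : k = q + q + r by rewrite /q /r; lia.
have q0 : 0 < q by rewrite /q; lia.
have kq : k <= 3 * q by rewrite /q; lia.
set N := grid_sum _ _ _.
pose w g := r ^ (s - g) * q ^ g.
have NE : N <= 3 * \sum_(g < s.+1) 'C(s, g) * (w g * 'C(g, g./2)).
  rewrite /N {1}kE; apply: leq_trans (@grid_sum_le q r s _ (fun g => 3 * 'C(g, g./2)) _) _.
    by move=> g c; apply: window_bin_le.
  by rewrite big_distrr; apply: leq_sum => g _; rewrite /w /=; apply: eq_leq; lia.
(* Divided by g + 1, AM-GM gives 2 a C(g, g/2) <= 2^g (1 + (s + 1) / (g + 1)), and C(s, g) (s + 1) /
   (g + 1) = C(s + 1, g + 1). *)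
have term g : 2 * a * ('C(s, g) * (w g * 'C(g, g./2))) <=
    w g * 2 ^ g * ('C(s, g) + 'C(s.+1, g.+1)).
  rewrite -(@leq_pmul2r (s.+1 * g.+1)) ?muln_gt0 //.
  have := central_bin_amgm a g; have := mul_bin_diag s.+1 g => /=.
  move: ha; move: ('C(s, g)) ('C(s.+1, g.+1)) ('C(g, g./2)) (w g) (2 ^ g) (a ^ 2).
  move=> c c' b v p a2 ha e am.
  have -> : 2 * a * (c * (v * b)) * (s.+1 * g.+1) = c * v * s.+1 * (2 * a * (b * g.+1)) by lia.
  apply: (@leq_trans (c * v * s.+1 * (p * (s.+1 + g.+1)))).
    rewrite leq_mul2l; apply/orP; right; apply: leq_trans am _.
    by rewrite leq_mul2l; apply/orP; right; lia.
  have -> : v * p * (c + c') * (s.+1 * g.+1) = v * p * s.+1 * (c * g.+1 + g.+1 * c') by lia.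
  by rewrite -e; apply: eq_leq; lia.
have wE g : w g * 2 ^ g = r ^ (s - g) * (q + q) ^ g.
  by rewrite /w -mulnA -expnMn (_ : q * 2 = q + q); lia.
have S1 : \sum_(g < s.+1) w g * 2 ^ g * 'C(s, g) = k ^ s.
  rewrite kE addnC expnDn; apply: eq_bigr => g _; rewrite wE; lia.
(* These are the terms of the expansion of (r + 2q)^(s + 1) other than r^(s + 1). *)
have S2 : (q + q) * \sum_(g < s.+1) w g * 2 ^ g * 'C(s.+1, g.+1) <= k ^ s.+1.
  rewrite [in leqRHS](_ : k = r + (q + q)); last by rewrite addnC.
  rewrite expnDn [in leqRHS]big_ord_recl big_distrr /=.
  apply: leq_trans (leq_addl _ _); apply: leq_sum => g _.
  rewrite /bump /= add1n wE subSS expnS; apply: eq_leq; lia.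
have : 2 * a * N <= 3 * (k ^ s + \sum_(g < s.+1) w g * 2 ^ g * 'C(s.+1, g.+1)).
  rewrite -S1 -big_split /=.
  apply: leq_trans (leq_mul (leqnn (2 * a)) NE) _.
  rewrite mulnCA leq_mul2l /= big_distrr; apply: leq_sum => g _.
  by rewrite -mulnDr; apply: term.
move: S2; set X := \sum_(_ < _) _; rewrite expnS; set K := k ^ s => S2 aN.
(* Both 2 q K and 2 q X are at most k K, so 9 q (K + X) <= 9 k K. *)
have : 2 * a * N * k <= 3 * (K + X) * (3 * q) by apply: leq_mul.
have : (q + q) * K <= k * K by rewrite leq_mul2r; apply/orP; right; lia.
lia.
Qed.

(** * Levels and chains over a class of coordinates *)

Section Grid.
Context {n k : nat}.
Implicit Types (x y : grid n k) (G : seq 'I_n).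

Definition coords x G : seq nat := [seq nat_of_ord (x i) | i <- G].

Definition level G t := [set x : grid n k | sumn (coords x G) == t].

Definition mid_level G := level G (size G * k.-1)./2.

Lemma all_coords x G : all (ltn^~ k) (coords x G).
Proof. by rewrite all_map; apply/allP => i _ /=. Qed.

Lemma size_coords x G : size (coords x G) = size G.
Proof. exact: size_map. Qed.

Lemma card_grid : #|grid n k| = k ^ n.
Proof. by rewrite card_ffun !card_ord. Qed.

(** Exchanging x_i with an independent value v is an involution on the pairs (x, v) that keeps the
    coordinates in [G]. *)
Lemma resample_coord i G (phi : nat -> nat) : i \notin G ->
  k * \sum_(x : grid n k) phi (x i + sumn (coords x G)) =
  \sum_(x : grid n k) \sum_(v < k) phi (v + sumn (coords x G)).
Proof.
move=> iG.
have -> : k * \sum_(x : grid n k) phi (x i + sumn (coords x G)) =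
    \sum_(x : grid n k) \sum_(v < k) phi (x i + sumn (coords x G)).
  by rewrite big_distrr; apply: eq_bigr => x _; rewrite sum_nat_const card_ord.
rewrite !pair_big /=.
pose swap (p : grid n k * 'I_k) : grid n k * 'I_k :=
  ([ffun j => if j == i then p.2 else p.1 j], p.1 i).
have swapK : involutive swap.
  case=> x v; rewrite /swap /= ffunE eqxx; congr pair.
  by apply/ffunP => j; rewrite !ffunE; case: eqP => [->|].
rewrite (reindex_inj (inv_inj swapK)); apply: eq_bigr => -[x v] _ /=.
rewrite ffunE eqxx; congr (phi (_ + sumn _)); apply/eq_in_map => j jG.
by rewrite ffunE; case: eqP iG => // <-; rewrite jG.
Qed.

Lemma sum_coords G (phi : nat -> nat) : uniq G ->
  k ^ size G * \sum_(x : grid n k) phi (sumn (coords x G)) = k ^ n * grid_sum k (size G) phi.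
Proof.
elim: G phi => [|i G IH] phi /=; first by rewrite mul1n sum_nat_const card_grid.
case/andP=> iG uG; rewrite -IH // expnS -mulnA mulnCA; congr muln.
exact: resample_coord.
Qed.

(** If the other coordinates of the class sum to S, the first one completes the sum to t for one of
    its k values when S <= t < S + k, and for none otherwise. *)
Lemma card_level_le G t a : 2 <= k -> uniq G -> 0 < size G -> a ^ 2 <= size G ->
  2 * a * k * #|level G t| <= 9 * k ^ n.
Proof.
case: G => // i G k2 /= /andP[iG uG] _ ha.
have e1 : k * #|level (i :: G) t| =
    \sum_(x : grid n k) (sumn (coords x G) <= t < sumn (coords x G) + k).
  have -> : #|level (i :: G) t| =
      \sum_(x : grid n k) (x i + sumn (coords x G) == t).
    rewrite /level -sum1dep_card big_mkcond; apply: eq_bigr => x _.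
    by rewrite /=; case: eqP.
  rewrite (resample_coord (fun z => z == t)) //; apply: eq_bigr => x _.
  set S := sumn _; have [/andP[St tS]|out] := boolP (S <= t < S + k).
    have lt : t - S < k by lia.
    rewrite (bigD1 (Ordinal lt)) //= big1 ?addn0 => [|v]; first by rewrite subnK ?eqxx.
    by rewrite -val_eqE /=; lia.
  by rewrite big1 // => v _; have := ltn_ord v; lia.
have := sum_coords (fun z => z <= t < z + k) uG; rewrite /= -e1 => e2.
have := grid_sum_window_le t k2 ha; move: e2.
set N := grid_sum _ _ _; rewrite expnS => e2 le.
have K0 : 0 < k * k ^ size G by rewrite muln_gt0 expn_gt0; lia.
rewrite -(leq_pmul2l K0).
have -> : k * k ^ size G * (2 * a * k * #|level (i :: G) t|) =
   2 * a * k * (k ^ size G * (k * #|level (i :: G) t|)) by lia.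
have -> : k * k ^ size G * (9 * k ^ n) = k ^ n * (9 * (k * k ^ size G)) by lia.
by rewrite e2 mulnCA leq_mul2l le orbT.
Qed.

Lemma coords_inj x y G i : coords x G = coords y G -> i \in G -> x i = y i.
Proof. by move=> /eq_in_map e /e /val_inj. Qed.

Lemma all2_coords x y G i : all2 leq (coords x G) (coords y G) -> i \in G -> x i <= y i.
Proof.
elim: G => //= j G IH /andP[xy c]; rewrite inE => /predU1P[->//|]; exact: IH.
Qed.

Lemma coords_nth G s : uniq G -> size s = size G ->
  [seq nth 0 s (index i G) | i <- G] = s.
Proof.
move=> uG sG; apply: (@eq_from_nth _ 0) => [|j]; rewrite size_map // => jG.
have [i0 _] : exists i, i \in G by case: (G) jG => // i0 ? _; exists i0; rewrite inE eqxx.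
by rewrite (nth_map i0) // index_uniq.
Qed.

Lemma set_coords x G s : uniq G -> size s = size G -> all (ltn^~ k) s ->
  exists2 y, coords y G = s & forall i, i \notin G -> y i = x i.
Proof.
move=> uG sG vs.
have sk i : i \in G -> nth 0 s (index i G) < k.
  by move=> iG; apply: (all_nthP 0 vs); rewrite sG index_mem.
pose y : grid n k := [ffun i => insubd (x i) (if i \in G then nth 0 s (index i G) else x i)].
exists y => [|i iG]; last by rewrite ffunE (negbTE iG) valKd.
rewrite -[RHS](coords_nth uG sG); apply/eq_in_map => i iG.
by rewrite ffunE iG val_insubd sk.
Qed.

(** By [chain_pos_sum], the point at position (l - 1)/2, rounded down, has the middle sum, rounded
    down. *)
Lemma chain_reaches_mid x G : uniq G ->
  exists y, [/\ y \in mid_level G, chain_id k (coords y G) = chain_id k (coords x G)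
    & forall i, i \notin G -> y i = x i].
Proof.
move=> uG; have vx := all_coords x G.
have [|s [vs ss es ps]] := chain_pos_surj (q := (chain_len k (coords x G)).-1./2) vx.
  by have := chain_pos_lt vx; lia.
rewrite size_coords in ss.
have [y yG yx] := set_coords x uG ss vs; exists y; rewrite yG; split=> //.
rewrite inE yG; have := chain_pos_sum vs; have := chain_id_len es.
have := chain_pos_lt vx; rewrite ps ss; lia.
Qed.

(** Equal keys mean the same chain in direction [G]: coordinates in [G] are blanked to 0 and enter
    only through their chain. *)
Definition chain_key G x :=
  (chain_id k (coords x G), [ffun i => if i \in G then 0 else nat_of_ord (x i)]).

Lemma chain_key_out G x y i : chain_key G x = chain_key G y -> i \notin G -> x i = y i.
Proof.
by case=> _ /ffunP/(_ i); rewrite !ffunE => + iG; rewrite (negbTE iG) => /val_inj.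
Qed.

Lemma card_le_mid G (A : {set grid n k}) : uniq G ->
  {in A &, forall x y, chain_key G x = chain_key G y -> x = y} -> #|A| <= #|mid_level G|.
Proof.
move=> uG iA; rewrite -[#|A|]muln1 -[#|mid_level G|]muln1.
apply: (@fibre_double_count _ _ (chain_key G)) => x xA.
  rewrite -(cards1 x); apply/subset_leq_card/subsetP => y; rewrite !inE => /andP[yA /eqP e].
  by rewrite (iA _ _ yA xA e).
have [y [ym ye yx]] := chain_reaches_mid x uG.
apply/card_gt0P; exists y; rewrite inE ym; apply/eqP; congr pair => //.
by apply/ffunP => i; rewrite !ffunE; case: ifPn => // /yx ->.
Qed.

(** A chain has at most one point at a position fixed by its length; [f] covers tops and bottoms
    alike. *)
Lemma card_pos_le_mid G (f : nat -> nat) : uniq G ->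
  #|[set x | chain_pos k (coords x G) == f (chain_len k (coords x G))]| <= #|mid_level G|.
Proof.
move=> uG; apply: card_le_mid => // x y; rewrite !inE => /eqP px /eqP py e.
have [ei _] := e; apply/ffunP => i; have [iG|] := boolP (i \in G); last exact: chain_key_out e.
apply: coords_inj iG; apply: (@chain_pos_inj k); rewrite ?all_coords //.
by rewrite px py (chain_id_len ei).
Qed.

End Grid.

(** * Thick diagonals *)

Section ThickDiagonals.
Context {n k d : nat} (c : 'I_n -> 'I_d.+1).
Implicit Types (x y : grid n k) (j : 'I_d.+1).

Definition colour_class j := [seq i <- enum 'I_n | c i == j].

Lemma mem_colour_class i j : (i \in colour_class j) = (c i == j).
Proof. by rewrite mem_filter mem_enum andbT. Qed.

Lemma colour_class_uniq j : uniq (colour_class j).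
Proof. by rewrite filter_uniq ?enum_uniq. Qed.

Let crd x j := coords x (colour_class j).
Let cid x j := chain_id k (crd x j).
Let pos x j := chain_pos k (crd x j).
Let len x j := chain_len k (crd x j).

Let pos_lt x j : pos x j < len x j.
Proof. by apply: chain_pos_lt; apply: all_coords. Qed.

Lemma id_pos_inj x y : cid x =1 cid y -> pos x =1 pos y -> x = y.
Proof.
move=> ixy pxy; apply/ffunP => i.
have iG : i \in colour_class (c i) by rewrite mem_colour_class.
by apply: coords_inj iG; apply: (@chain_pos_inj k); rewrite ?all_coords //; [apply: ixy|apply: pxy].
Qed.

Lemma id_pos_mono x y : cid x =1 cid y -> (forall j, pos x j <= pos y j) -> grid_le x y.
Proof.
move=> ixy pxy; apply/forallP => i.
have iG : i \in colour_class (c i) by rewrite mem_colour_class.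
apply: all2_coords iG; apply: (@chain_pos_mono k); rewrite ?all_coords //.
  exact: ixy.
exact: pxy.
Qed.

Lemma pos_surj x (q : 'I_d.+1 -> nat) : (forall j, q j < len x j) ->
  exists2 y, cid y =1 cid x & pos y =1 q.
Proof.
move=> ql.
have ex j : exists y, cid y j = cid x j /\ pos y j = q j.
  have [s [vs ss es ps]] := chain_pos_surj (all_coords x (colour_class j)) (ql j).
  rewrite size_coords in ss.
  have [y ys _] := set_coords x (colour_class_uniq j) ss vs.
  by exists y; rewrite /cid /pos /crd ys.
(* The classes partition the coordinates, so one witness per class can be glued. *)
have [f fP] := fin_all_exists ex; pose y : grid n k := [ffun i => f (c i) i].
have crdy j : crd y j = crd (f j) j.
  by apply/eq_in_map => i; rewrite mem_colour_class ffunE => /eqP ->.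
exists y => j; rewrite /cid /pos crdy; by case: (fP j).
Qed.

(** [b x j] is the block index on the chain of class j. The least of these, [depth x], is the number
    of steps down the diagonal to its first block. With [d.+1] classes, [ord0] can seed the
    minimum. *)
Let b x j := (pos x j)./2.
Let depth x := b x [arg min_(j < ord0) b x j].

Let depth_le x j : depth x <= b x j.
Proof. by rewrite /depth; case: arg_minnP => // j0 _; apply. Qed.

Let depth_attained x : exists j, depth x = b x j.
Proof. by exists [arg min_(j < ord0) b x j]. Qed.

(* Along a fixed diagonal all block indices increase simultaneously with the
   depth, so two points of different depth are comparable. *)
Definition diagonal x := [ffun j => (cid x j, b x j - depth x)].

Let diagonalP x y : diagonal x = diagonal y ->
  cid x =1 cid y /\ (forall j, b x j - depth x = b y j - depth y).
Proof. by move=> /ffunP e; split=> j; have := e j; rewrite !ffunE => -[]. Qed.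

(* Blocks pair the positions 2b and 2b + 1 of a chain, so a chain of odd length
   leaves its top point unpaired. *)
Definition odd_top x := [exists j, (pos x j == (len x j).-1) && ~~ odd (pos x j)].

(** The points of depth 0, which form the first blocks of the diagonals. *)
Definition low := [set x | [exists j, pos x j <= 1]].

Let card_exists_le (p : 'I_d.+1 -> pred (grid n k)) (u : 'I_d.+1 -> nat) :
  (forall j, #|[set x | p j x]| <= u j) -> #|[set x | [exists j, p j x]]| <= \sum_j u j.
Proof.
move=> pu; apply: leq_trans (leq_sum _ (fun j _ => pu j)).
rewrite -sum1dep_card; under [leqRHS]eq_bigr do rewrite -sum1dep_card.
rewrite (exchange_big_dep xpredT) //= big_mkcond; apply: leq_sum => x _.
by case: existsP => // -[j pj]; rewrite (bigD1 j).
Qed.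

Let mu j := #|mid_level (k := k) (colour_class j)|.

Lemma card_odd_top : #|[set x | odd_top x]| <= \sum_j mu j.
Proof.
apply: card_exists_le => j.
apply: leq_trans (card_pos_le_mid (k := k) predn (colour_class_uniq j)).
by apply/subset_leq_card/subsetP => x; rewrite !inE => /andP[].
Qed.

Lemma card_low : #|low| <= 2 * \sum_j mu j.
Proof.
rewrite big_distrr; apply: card_exists_le => j /=; rewrite mul2n -addnn.
have h f := card_pos_le_mid (k := k) f (colour_class_uniq j).
apply: leq_trans (leq_add (h (fun=> 0)) (h (fun=> 1))).
apply: leq_trans (leq_card_setU _ _); apply/subset_leq_card/subsetP => x.
by rewrite !inE /pos /crd; lia.
Qed.

(** Moving the block of x down by [depth x] reaches the first block. Every parity pattern e occurs
    there: as x is not in [odd_top], both positions of each pair exist on the chain. *)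
Lemma diagonal_low_card x : ~~ odd_top x ->
  2 ^ d.+1 <= #|[set y in low | diagonal y == diagonal x]|.
Proof.
move=> /existsPn tx.
have ex (e : {ffun 'I_d.+1 -> bool}) : exists y,
    [/\ y \in low, diagonal y = diagonal x & [ffun j => odd (pos y j)] = e].
  have ql j : (b x j - depth x).*2 + e j < len x j.
    have := tx j; have := pos_lt x j; rewrite /b.
    by move: (pos x j) (len x j) (depth x) => p l m; case: (e j); lia.
  have [y iy py] := pos_surj ql.
  have byE j : b y j = b x j - depth x by rewrite {1}/b py addnC half_bit_double.
  have [j0 dx] := depth_attained x.
  have y0 : depth y = 0 by have := depth_le y j0; rewrite byE; lia.
  exists y; split.
  - rewrite inE; apply/existsP; exists j0; rewrite py; case: (e j0); lia.
  - by apply/ffunP => j; rewrite !ffunE byE y0 subn0; congr pair; apply: iy.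
  - by apply/ffunP => j; rewrite ffunE py; case: (e j); lia.
have [f fP] := fin_all_exists ex.
have fi : injective f.
  by move=> e e' ee; have [_ _ <-] := fP e; have [_ _ <-] := fP e'; rewrite ee.
have <- : #|{ffun 'I_d.+1 -> bool}| = 2 ^ d.+1 by rewrite card_ffun card_bool card_ord.
rewrite -(card_imset _ fi).
apply/subset_leq_card/subsetP => _ /imsetP[e _ ->].
by rewrite inE; have [-> -> _] := fP e; rewrite eqxx.
Qed.

(** On a diagonal, the depth fixes all block indices, and the parities then fix the point. *)
Lemma card_diagonal_depth x a :
  #|[set y | (diagonal y == diagonal x) && (depth y == a)]| <= 2 ^ d.+1.
Proof.
have <- : #|{ffun 'I_d.+1 -> bool}| = 2 ^ d.+1 by rewrite card_ffun card_bool card_ord.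
apply: (@leq_card_in _ _ (fun y => [ffun j => odd (pos y j)])) => y z.
rewrite !inE => /andP[/eqP Dy /eqP dy] /andP[/eqP Dz /eqP dz] /ffunP e.
have [iy byE] := diagonalP (etrans Dy (esym Dz)).
apply: id_pos_inj => // j.
have := e j; rewrite !ffunE; have := byE j; have := depth_le y j; have := depth_le z j.
rewrite /b; lia.
Qed.

Lemma card_diagonal_weak_free disp (P : finPOrderType disp) (F : {set grid n k}) x :
  ~ contains_weak_copy (fun x y : P => (x <= y)%O) (@grid_le n k) F ->
  #|[set y in F | diagonal y == diagonal x]| <=
    height_of (fun x y : P => (x <= y)%O) * (#|P| + 2 ^ d.+1).
Proof.
move=> nF; rewrite leqNgt; apply/negP => /ltnW le; apply: nF.
have [|u v|a|pi [pi_inj piF pi_mono]] :=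
  weak_copy_of_levels (rQ := @grid_le n k) (m := depth) _ _ _ le.
- by move=> u; apply/forallP => i.
- rewrite !inE => /andP[_ /eqP Du] /andP[_ /eqP Dv] duv.
  have [iuv buv] := diagonalP (etrans Du (esym Dv)).
  apply: id_pos_mono => // j; have := buv j; have := depth_le u j; have := depth_le v j.
  rewrite /b; lia.
- apply: leq_trans (card_diagonal_depth x a).
  by apply/subset_leq_card/subsetP => y; rewrite !inE => /andP[/andP[_ ->]].
by exists pi; split=> // u; have := piF u; rewrite inE => /andP[].
Qed.

(** With S the sum over the classes, points in [odd_top] cost S. The others are weighed against
    [low] diagonal by diagonal and cost 2S * 2h, since |P| + 2^(d + 1) is at most twice 2^(d +
    1). *)
Lemma weak_free_card_le disp (P : finPOrderType disp) (F : {set grid n k}) :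
  #|P| <= 2 ^ d.+1 -> 0 < #|P| ->
  ~ contains_weak_copy (fun x y : P => (x <= y)%O) (@grid_le n k) F ->
  #|F| <= 5 * height_of (fun x y : P => (x <= y)%O) *
          \sum_j #|mid_level (k := k) (colour_class j)|.
Proof.
move=> Pd P0 nF; set h := height_of _.
have h0 : 0 < h.
  have /card_gt0P[p _] := P0; exact: leq_ltn_trans (poset_rank_lt_height p).
rewrite -(cardsID [set x | odd_top x] F); set F' := _ :\: _.
have nF' : ~ contains_weak_copy (fun x y : P => (x <= y)%O) (@grid_le n k) F'.
  case=> pi [pi_inj piF pi_mono]; apply: nF; exists pi; split=> // x.
  by have := piF x; rewrite inE => /andP[].
have : #|F'| * 2 ^ d.+1 <= #|low| * (h * (#|P| + 2 ^ d.+1)).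
  apply: (fibre_double_count (D := diagonal)) => x xF.
    exact: card_diagonal_weak_free.
  by apply: diagonal_low_card; move: xF; rewrite !inE => /andP[].
have : #|F :&: [set x | odd_top x]| <= \sum_j mu j.
  by apply: leq_trans card_odd_top; apply/subset_leq_card/subsetIr.
have := card_low; rewrite -/mu; set S := \sum_j _.
set t := 2 ^ d.+1 in Pd *; move: #|low| => L LS oS FL.
have t0 : 0 < t by rewrite expn_gt0.
have : #|F'| <= L * (h * 2).
  rewrite -(leq_pmul2r t0); apply: leq_trans FL _.
  by rewrite -!mulnA !leq_mul2l; apply/orP; right; apply/orP; right; lia.
have : L * (h * 2) <= 2 * S * (h * 2) by rewrite leq_mul2r LS orbT.
have : S <= h * S by rewrite leq_pmull.
lia.
Qed.

End ThickDiagonals.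

(** * The width of the grid *)

Definition absdiff a b := (a - b) + (b - a).

(* The shift a - b and the centred value 2v - (k - 1) are uncorrelated. *)
Lemma sum_dist_sq k a b :
  \sum_(v < k) absdiff (v.*2 + a) (k.-1 + b) ^ 2 <= k * (absdiff a b ^ 2 + k ^ 2).
Proof.
(* Pairing v with k - 1 - v cancels the cross terms. *)
rewrite -(@leq_pmul2l 2) // mul2n -addnn {2}(reindex_inj rev_ord_inj) -big_split /=.
rewrite mulnCA -[k in k * _]card_ord -sum_nat_const; apply: leq_sum => v _.
have vk := ltn_ord v; move: (nat_of_ord v) vk => u uk.
have [a0|a0] := leqP b a; have [h1|h1] := leqP (k.-1 + b) (u.*2 + a);
have [h2|h2] := leqP (k.-1 + b) ((k - u.+1).*2 + a);
rewrite /absdiff -!mulnn; nia.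
Qed.

(** Summing out one coordinate turns a bound c D^2 + e into c k D^2 + c k^3 + k e, so the induction
    runs over quadratic bounds. *)
Lemma grid_sum_dist_sq k s a b c e (phi : nat -> nat) :
  (forall y, phi y <= c * absdiff (y.*2 + a) (s * k.-1 + b) ^ 2 + e) ->
  grid_sum k s phi <= k ^ s * (c * (absdiff a b ^ 2 + s * k ^ 2) + e).
Proof.
elim: s phi c e => [|s IH] phi c e H /=.
  by rewrite mul1n !mul0n addn0; have := H 0; rewrite add0n mul0n.
have {}IH := IH (fun y => \sum_(v < k) phi (v + y)) (c * k) (c * k ^ 3 + k * e) _.
apply: leq_trans (IH _) _ => [y|]; last first.
  rewrite (expnS k s) -[k ^ 3]/(k * (k * k)) -[k ^ 2]/(k * k) mulSn.
  by move: (k ^ s) (absdiff a b ^ 2) => K D; apply: eq_leq; lia.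
apply: (@leq_trans (\sum_(v < k) (c * absdiff ((v + y).*2 + a) (s.+1 * k.-1 + b) ^ 2 + e))).
  by apply: leq_sum => v _; apply: H.
rewrite big_split sum_nat_const card_ord -big_distrr /= addnA leq_add2r.
have -> : \sum_(v < k) absdiff ((v + y).*2 + a) (s.+1 * k.-1 + b) ^ 2 =
          \sum_(v < k) absdiff (v.*2 + (y.*2 + a)) (k.-1 + (s * k.-1 + b)) ^ 2.
  by apply: eq_bigr => v _; congr (absdiff _ _ ^ 2); lia.
have := sum_dist_sq k (y.*2 + a) (s * k.-1 + b).
rewrite -[k ^ 3]/(k * k ^ 2); move: (absdiff _ _ ^ 2) (k ^ 2) (\sum_(_ < _) _) => D K S h.
apply: (@leq_trans (c * (k * (D + K)))); first by rewrite leq_mul2l h orbT.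
by apply: eq_leq; lia.
Qed.

Section Width.
Context {n k : nat}.
Implicit Types (x y : grid n k).

Let total x := sumn (coords x (enum 'I_n)).

Let totalE x : total x = \sum_i x i.
Proof. by rewrite /total sumnE big_map big_enum. Qed.

Lemma level_antichain t : is_antichain (@grid_le n k) (level (enum 'I_n) t).
Proof.
apply/forallP => x; apply/implyP; rewrite inE => /eqP xt.
apply/forallP => y; apply/implyP; rewrite inE => /eqP yt; apply/implyP => /forallP xy.
have : \sum_i x i == \sum_i y i by rewrite -!totalE /total xt yt.
have /leqif_sum -> : forall i : 'I_n, true -> x i <= y i ?= iff (x i == y i :> nat).
  by move=> i _; split.
by move=> /forallP e; apply/eqP/ffunP => i; apply/val_inj/eqP; have := e i.
Qed.

Lemma level_le_width t : #|level (n := n) (k := k) (enum 'I_n) t| <= width_of (@grid_le n k).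
Proof. exact: (@leq_bigmax_cond _ _ (fun A : {set _} => #|A|)) (level_antichain t). Qed.

Lemma total_variance : 0 < k ->
  \sum_x absdiff (total x).*2 (n * k.-1) ^ 2 <= k ^ n * (n * k ^ 2).
Proof.
move=> k0.
have := sum_coords (k := k) (fun s => absdiff s.*2 (n * k.-1) ^ 2) (enum_uniq 'I_n).
rewrite size_enum_ord => /eqP; rewrite eqn_pmul2l ?expn_gt0 ?k0 // => /eqP ->.
apply: leq_trans (@grid_sum_dist_sq k n 0 0 1 0 _ _) _ => [y|].
  by rewrite !addn0 mul1n.
by rewrite mul1n addn0.
Qed.

(* Chebyshev: most points lie in the 2ka + 1 levels nearest to the middle. *)
Lemma width_ge a : 0 < k -> 0 < a -> n <= a ^ 2 ->
  k ^ n <= 4 * k * a * width_of (@grid_le n k).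
Proof.
move=> k0 a0 na; pose l := 2 * k * a; set w := width_of _.
pose far := [set x | l <= absdiff (total x).*2 (n * k.-1)].
have farE : 4 * #|far| <= k ^ n.
  have l0 : 0 < k ^ 2 * a ^ 2 by rewrite muln_gt0 !expn_gt0 k0 a0.
  rewrite -(leq_pmul2r l0); apply: (@leq_trans (#|far| * l ^ 2)).
    by rewrite /l !expnMn; apply: eq_leq; lia.
  apply: (@leq_trans (k ^ n * (n * k ^ 2))).
    apply: leq_trans (total_variance k0); rewrite -sum_nat_const.
    rewrite [leqLHS]big_mkcond; apply: leq_sum => x _; case: ifP => //.
    by rewrite inE leq_sqr.
  by rewrite leq_mul2l [k ^ 2 * _]mulnC leq_mul2r na !orbT.
(* The near points have totals between t0 and t0 + l, also when the subtraction truncates. *)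
pose t0 := (n * k.-1 - l)./2.
have nearE : #|~: far| <= l.+1 * w.
  rewrite -[l.+1]card_ord -sum_nat_const.
  apply: leq_trans (leq_sum _ (fun (u : 'I_l.+1) _ => level_le_width (t0 + u))).
  rewrite -sum1_card; under [leqRHS]eq_bigr do rewrite -sum1_card.
  rewrite (exchange_big_dep xpredT) //= big_mkcond; apply: leq_sum => x _.
  rewrite !inE -ltnNge; case: ifP => // xl.
  have ul : total x - t0 < l.+1 by move: xl; rewrite /t0 /absdiff; lia.
  rewrite (bigD1 (Ordinal ul)) //= inE -/(total x).
  by apply/eqP; move: xl; rewrite /t0 /absdiff; lia.
have := cardsC far; rewrite card_grid => fE.
(* At least 3/4 of the grid lies on at most 3ka levels, hence the factor 4. *)
have : l.+1 * w <= 3 * (k * a) * w by rewrite leq_mul2r; apply/orP; right; rewrite /l; nia.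
lia.
Qed.

(** Take all coordinates as one class: an antichain meets each symmetric chain at most once. *)
Lemma width_le_mid : width_of (@grid_le n k) <= #|mid_level (n := n) (k := k) (enum 'I_n)|.
Proof.
apply/bigmax_leqP => A /forallP hA; apply: card_le_mid => [|x y xA yA [e _]].
  exact: enum_uniq.
have anti u v : u \in A -> v \in A -> grid_le u v -> u = v.
  move=> uA vA uv; apply/eqP.
  by have /implyP/(_ uA)/forallP/(_ v)/implyP/(_ vA)/implyP := hA u; apply.
have cmp (u v : grid n k) : chain_id k (coords u (enum 'I_n)) = chain_id k (coords v (enum 'I_n)) ->
    chain_pos k (coords u (enum 'I_n)) <= chain_pos k (coords v (enum 'I_n)) -> grid_le u v.
  move=> euv puv; apply/forallP => i.
  apply: (@all2_coords _ _ _ _ (enum 'I_n)); last exact: mem_enum.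
  exact: (chain_pos_mono (all_coords _ _) (all_coords _ _) euv puv).
case/orP: (leq_total (chain_pos k (coords x (enum 'I_n))) (chain_pos k (coords y (enum 'I_n)))).
  by move=> /(cmp _ _ e)/(anti _ _ xA yA).
by move=> /(cmp _ _ (esym e))/(anti _ _ yA xA).
Qed.

End Width.

Lemma width_boolean_grid n : width_of (@grid_le n 2) <= 'C(n, n./2).
Proof.
apply: leq_trans width_le_mid _.
rewrite -[n in 'C(n, _)]card_ord -card_draws.
pose supp (x : grid n 2) := [set i | x i != ord0].
have supp_inj : injective supp.
  move=> x y /setP e; apply/ffunP => i; have := e i; rewrite !inE.
  rewrite -!val_eqE /= => h; apply: val_inj => /=.
  move: h (ltn_ord (x i)) (ltn_ord (y i)).
  by case: (nat_of_ord (x i)) => [|[|?]]; case: (nat_of_ord (y i)) => [|[|?]].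
rewrite -(card_imset _ supp_inj); apply/subset_leq_card/subsetP => _ /imsetP[x xm ->].
move: xm; rewrite !inE size_enum_ord muln1 sumnE big_map big_enum /= => /eqP <-.
rewrite -sum1_card big_mkcond; apply/eqP/eq_bigr => i _; rewrite inE.
by rewrite -val_eqE /=; have := ltn_ord (x i); case: (nat_of_ord (x i)) => [|[|]].
Qed.

(** * The bound *)

Definition residue n d (i : 'I_n) : 'I_d.+1 := inord (i %% d.+1).

Lemma size_residue_class n d (j : 'I_d.+1) :
  n %/ d.+1 <= size (colour_class (@residue n d) j).
Proof.
have lt (u : 'I_(n %/ d.+1)) : u * d.+1 + j < n.
  apply: leq_trans (leq_divM n d.+1); apply: (@leq_trans (u.+1 * d.+1)).
    by rewrite mulSn addnC ltn_add2r.
  by rewrite leq_mul2r ltn_ord orbT.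
rewrite -(card_uniqP (colour_class_uniq _ _)) -[n %/ _]card_ord.
rewrite -(card_imset _ (f := fun u => Ordinal (lt u))); last first.
  by move=> u v /(congr1 val)/eqP /=; rewrite eqn_add2r eqn_pmul2r // => /eqP/val_inj.
apply/subset_leq_card/subsetP => _ /imsetP[u _ ->].
by rewrite mem_colour_class /residue /= modnMDl modn_small // inord_val.
Qed.

(** Here a and a' replace sqrt(n / (d + 1)) from below and sqrt n from above. Since 2 a k mu <= 9
    k^n <= 36 k a' w for each class, the constant is 5 * 18. *)
Lemma weak_free_le_width disp (P : finPOrderType disp) n k d a a' (F : {set grid n k}) :
  2 <= k -> 0 < #|P| -> #|P| <= 2 ^ d.+1 -> d < n ->
  a ^ 2 <= n %/ d.+1 -> 0 < a' -> n <= a' ^ 2 ->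
  ~ contains_weak_copy (fun x y : P => (x <= y)%O) (@grid_le n k) F ->
  a * #|F| <= 90 * height_of (fun x y : P => (x <= y)%O) * d.+1 * a' * width_of (@grid_le n k).
Proof.
move=> k2 P0 Pd dn ha a'0 ha' nF; set h := height_of _; set w := width_of _.
have k0 : 0 < k by lia.
pose mu j := #|mid_level (n := n) (k := k) (colour_class (@residue n d) j)|.
have muE j : a * mu j <= 18 * a' * w.
  have sj := size_residue_class n j.
  have := card_level_le (k := k) ((size (colour_class (@residue n d) j) * k.-1)./2) k2
    (colour_class_uniq _ _) (leq_trans _ sj) (leq_trans ha sj).
  rewrite divn_gt0 // => /(_ dn); rewrite -[level _ _]/(mid_level _) -/(mu j).
  have := width_ge k0 a'0 ha'; rewrite -/w => W M.
  have MW : 2 * a * k * mu j <= 9 * (4 * k * a' * w).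
    by apply: leq_trans M _; rewrite leq_mul2l W.
  by rewrite -(@leq_pmul2l (2 * k)) ?muln_gt0 //; lia.
have := weak_free_card_le (@residue n d) Pd P0 nF; rewrite -/h => Fle.
apply: (@leq_trans (a * (5 * h * \sum_j mu j))); first by rewrite leq_mul2l Fle orbT.
have S : a * \sum_j mu j <= d.+1 * (18 * a' * w).
  rewrite big_distrr -[d.+1 in X in _ <= X]card_ord -sum_nat_const.
  by apply: leq_sum => j _; apply: muE.
apply: (@leq_trans (5 * h * (d.+1 * (18 * a' * w)))).
  by rewrite mulnCA leq_mul2l S orbT.
by apply: eq_leq; lia.
Qed.

(** * Passage to real numbers *)

Lemma INR_exp m e : INR (m ^ e) = (INR m ^ e)%R.
Proof. by elim: e => [//|e IH]; rewrite expnS mult_INR IH. Qed.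

Lemma leq_INR m n : m <= n -> (INR m <= INR n)%R.
Proof. by move=> /leP; apply: le_INR. Qed.

Lemma ln_le x y : (0 < x)%R -> (x <= y)%R -> (ln x <= ln y)%R.
Proof. by move=> x0 [/(ln_increasing _ _ x0) /Rlt_le|->] //; apply: Rle_refl. Qed.

Lemma log2_ge1 N : 2 <= N -> (1 <= log2 (INR N))%R.
Proof.
move=> N2; have l2 : (0 < ln 2)%R by rewrite -ln_1; apply: ln_increasing; lra.
apply: (Rmult_le_reg_r (ln 2)) => //.
rewrite /log2 /Rdiv Rmult_assoc Rinv_l; last lra.
rewrite Rmult_1_l Rmult_1_r; apply: ln_le; first lra.
exact: (leq_INR N2).
Qed.

(** Rounding up adds at most 1, which is at most log2 N. *)
Lemma up_log_le_log2 N : 2 <= N -> (INR (up_log 2 N) <= 2 * log2 (INR N))%R.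
Proof.
move=> N2; have L1 := log2_ge1 N2.
have l2 : (0 < ln 2)%R by rewrite -ln_1; apply: ln_increasing; lra.
have /andP[lo _] := up_log_bounds (isT : 1 < 2) N2.
suff : (INR (up_log 2 N).-1 <= log2 (INR N))%R.
  have u0 : 0 < up_log 2 N by rewrite up_log_gt0.
  by rewrite -[in X in _ -> X](prednK u0) S_INR; lra.
apply: (Rmult_le_reg_r (ln 2)) => //.
rewrite /log2 /Rdiv Rmult_assoc Rinv_l; last lra.
rewrite Rmult_1_r -ln_pow; last lra.
have := leq_INR (ltnW lo); rewrite INR_exp => h.
by apply: ln_le h; apply: pow_lt; rewrite /=; lra.
Qed.

(** Keeping w abstract serves both the width and the central binomial coefficient. *)
Lemma nat_bound_to_real N n (f h w : nat) :
  2 <= N -> (INR n >= 2 * log2 (INR N))%R ->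
  (forall d a a', N <= 2 ^ d.+1 -> d < n -> a ^ 2 <= n %/ d.+1 -> 0 < a' -> n <= a' ^ 2 ->
    a * f <= 90 * h * d.+1 * a' * w) ->
  (INR f <= 1440 * INR w * INR h * Rpower (log2 (INR N)) (3 / 2))%R.
Proof.
move=> N2 nL H; set L := log2 _ in nL *.
have L1 : (1 <= L)%R := log2_ge1 N2.
have D2 : (INR (up_log 2 N) <= 2 * L)%R := up_log_le_log2 N2.
have Nu : N <= 2 ^ up_log 2 N by apply: up_logP.
have u0 : 0 < up_log 2 N by rewrite up_log_gt0.
have dn : up_log 2 N <= n by apply/leP/INR_le; lra.
move: u0 D2 Nu dn; case: (up_log 2 N) => // d _ D2 Nu dn.
(* For n > 0, a' is sqrt n rounded up. *)
pose q := n %/ d.+1; pose a := Nat.sqrt q; pose a' := (Nat.sqrt n.-1).+1.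
have q0 : 0 < q by rewrite divn_gt0.
have [a1 a2] := Nat.sqrt_spec q (Nat.le_0_l _); rewrite -/a in a1 a2.
have [b1 b2] := Nat.sqrt_spec n.-1 (Nat.le_0_l _).
have qn : n < q.+1 * d.+1 by apply: ltn_ceil.
have aF := H d a a' Nu dn _ _ _.
have a0 : 0 < a by nia.
have {}aF : a * f <= 90 * h * d.+1 * a' * w by apply: aF; rewrite -?mulnn /a'; nia.
(* Rounding costs a factor 4 in each square: a'^2 <= 4n and q + 1 <= (a + 1)^2 <= 4 a^2. *)
have ab : a' * a' <= 16 * (a * a) * d.+1.
  have n4 : a' * a' <= 4 * n by rewrite /a'; nia.
  have : q.+1 <= 4 * (a * a) by nia.
  by move=> /(leq_mul (leqnn d.+1)); lia.
have Dp : (0 < INR d.+1)%R by apply: lt_0_INR; lia.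
have ap : (0 < INR a)%R by apply/lt_0_INR/ltP.
set S := sqrt (INR d.+1).
have S0 : (0 <= S)%R by apply: sqrt_pos.
have SS : (S * S = INR d.+1)%R by apply: sqrt_sqrt; lra.
have a'S : (INR a' <= 4 * INR a * S)%R.
  apply: Rsqr_incr_0_var; last by apply: Rmult_le_pos => //; lra.
  have := leq_INR ab; rewrite !mult_INR /Rsqr => e.
  have -> : (4 * INR a * S * (4 * INR a * S) = 16 * (INR a * INR a) * (S * S))%R by ring.
  by rewrite SS; move: e; rewrite (_ : INR 16 = 16%R) //; rewrite /=; lra.
have RL : Rpower L (3 / 2) = (L * sqrt L)%R.
  rewrite (_ : (3 / 2)%R = (1 + / 2)%R); last by field.
  by rewrite Rpower_plus Rpower_1 ?Rpower_sqrt //; lra.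
(* With d + 1 <= 2L this gives the last factor of 1440 = 90 * 4 * 4. *)
have DS : (INR d.+1 * S <= 4 * (L * sqrt L))%R.
  have SL : (S <= 2 * sqrt L)%R.
    rewrite -(sqrt_square 2); last lra.
    rewrite -sqrt_mult; [|lra..]; apply: sqrt_le_1_alt; lra.
  have := sqrt_pos L; nra.
rewrite RL; apply: (Rmult_le_reg_l (INR a)) => //.
have := leq_INR aF; rewrite !mult_INR (_ : INR 90 = 90%R); last by rewrite /=; lra.
have h0 := pos_INR h; have w0 := pos_INR w.
move=> e; apply: Rle_trans e _.
have hw : (0 <= INR h * INR w)%R by apply: Rmult_le_pos.
apply: (@Rle_trans _ (90 * INR h * INR d.+1 * (4 * INR a * S) * INR w)%R).
  apply: Rmult_le_compat_r => //; apply: Rmult_le_compat_l => //.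
  by apply: Rmult_le_pos; [apply: Rmult_le_pos; lra|lra].
have -> : (90 * INR h * INR d.+1 * (4 * INR a * S) * INR w =
  360 * INR a * (INR h * INR w) * (INR d.+1 * S))%R by ring.
have -> : (INR a * (1440 * INR w * INR h * (L * sqrt L)) =
  360 * INR a * (INR h * INR w) * (4 * (L * sqrt L)))%R by ring.
apply: Rmult_le_compat_l => //; apply: Rmult_le_pos => //; lra.
Qed.

Theorem theorem1p5 :
  exists C : R,
    (forall (d : Order.disp_t) (P : finPOrderType d) (k n : nat),
        (2 <= #|P|)%N -> (2 <= k)%N -> (0 < n)%N ->
        (INR n >= 2 * log2 (INR #|P|))%R ->
        forall F : {set grid n k},
          ~ contains_weak_copy (fun x y : P => (x <= y)%O) (@grid_le n k) F ->
          (INR #|F| <=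
             C * INR (width_of (@grid_le n k)) * INR (height_of (fun x y : P => (x <= y)%O))
               * Rpower (log2 (INR #|P|)) (3 / 2))%R)
    /\
    (forall (d : Order.disp_t) (P : finPOrderType d) (n : nat),
        (2 <= #|P|)%N -> (0 < n)%N ->
        (INR n >= 2 * log2 (INR #|P|))%R ->
        forall F : {set {set 'I_n}},
          ~ contains_weak_copy (fun x y : P => (x <= y)%O) (@subset_le n) F ->
          (INR #|F| <=
             C * INR 'C(n, n./2) * INR (height_of (fun x y : P => (x <= y)%O))
               * Rpower (log2 (INR #|P|)) (3 / 2))%R).
Proof.
exists 1440%R; split=> [disp P k n P2 k2 _ nL F nF|disp P n P2 _ nL F nF].
  apply: (nat_bound_to_real P2 nL) => d a a' Pd dn ha a'0 ha'.
  by apply: weak_free_le_width nF => //; lia.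
pose ind (A : {set 'I_n}) : grid n 2 := [ffun i => inord (i \in A)].
have indE A i : ind A i = (i \in A) :> nat by rewrite ffunE inordK // ltnS leq_b1.
have ind_inj : injective ind.
  move=> A B /ffunP e; apply/setP => i.
  by have := congr1 val (e i); rewrite /= !indE; case: (i \in A); case: (i \in B).
rewrite -(card_imset _ ind_inj).
have nF' : ~ contains_weak_copy (fun x y : P => (x <= y)%O) (@grid_le n 2) (ind @: F).
  case=> pi [pi_inj piF pi_mono]; apply: nF.
  have ex x : exists A, A \in F /\ ind A = pi x.
    by have /imsetP[A AF e] := piF x; exists A.
  have [f fP] := fin_all_exists ex; exists f; split=> [x y e|x|x y /pi_mono].
  - by apply: pi_inj; have [_ <-] := fP x; have [_ <-] := fP y; rewrite e.
  - by case: (fP x).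
  have [_ <-] := fP x; have [_ <-] := fP y; move=> /forallP le.
  by apply/subsetP => i iA; have := le i; rewrite !indE iA; case: (i \in _).
apply: (nat_bound_to_real P2 nL) => d a a' Pd dn ha a'0 ha'.
apply: leq_trans (weak_free_le_width _ _ Pd dn ha a'0 ha' nF') _ => //; first by lia.
by rewrite leq_mul2l width_boolean_grid orbT.
Qed.
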